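(* If $n \geq 1$ is an integer and $A\subseteq\omega$ is an $n$-c.e. set that has an asymptotic density, then $\rho(A)$ is a difference of two left-$\Pi^0_2$ reals.
   Context: For $X \subseteq \omega=\{0,1,2,\dots\}$ and an integer $m>0$, let $\rho_m(X) = |\{j \in X : j < m\}|/m$. The set $X$ has a (asymptotic) density if $\lim_m \rho_m(X)$ exists, and the density is then $\rho(X) = \lim_m \rho_m(X)$. Sets are identified with their characteristic functions. For a natural number $n$, a set $A \subseteq \omega$ is $n$-c.e. if there is a computable function $g:\omega\times\omega\to\{0,1\}$ such that for all $x$: $g(x,0)=0$, $A(x)=\lim_s g(x,s)$, and $|\{s : g(x,s) \neq g(x,s+1)\}| \leq n$. A real $r$ is left-$\Pi^0_2$ if its left Dedekind cut $\{q \in \mathbb{Q} : q < r\}$ is a $\Pi^0_2$ set. *)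

(* Defs.v *)
From HB Require Import structures.
From mathcomp Require Import all_boot all_order all_algebra.
From mathcomp Require Import all_classical all_reals all_analysis.
Import Order.TTheory GRing.Theory Num.Theory numFieldNormedType.Exports.

Set Implicit Arguments.
Unset Strict Implicit.
Unset Printing Implicit Defensive.

Local Open Scope classical_set_scope.
Local Open Scope card_scope.
Local Open Scope ring_scope.

(** Codes for Kleene's partial recursive functions of a given arity. *)
Inductive recalg : nat -> Type :=
| ra_zero k : recalg k
| ra_succ : recalg 1
| ra_proj k (i : 'I_k) : recalg k
| ra_comp k l (f : recalg l) (gs : 'I_l -> recalg k) : recalg k
| ra_rec k (f : recalg k) (g : recalg k.+2) : recalg k.+1
| ra_min k (f : recalg k.+1) : recalg k.

(** [ra_eval e v y]: the computation of [e] on input [v] halts with output [y].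
    In the [ra_rec] case the recursion variable is the head of [v] and [t]
    lists the successive values of the recursion.  In the [ra_min] case [y] is
    the least zero, all values of [f] below [y] being defined and nonzero. *)
Fixpoint ra_eval k (e : recalg k) : k.-tuple nat -> nat -> Prop :=
  match e in recalg k return k.-tuple nat -> nat -> Prop with
  | ra_zero _ => fun _ y => y = 0%N
  | ra_succ => fun v y => y = (thead v).+1
  | ra_proj _ i => fun v y => y = tnth v i
  | ra_comp _ l f gs => fun v y =>
      exists w : l.-tuple nat,
        (forall i, ra_eval (gs i) v (tnth w i)) /\ ra_eval f w y
  | ra_rec k f g => fun v y =>
      let p : k.-tuple nat := [tuple of behead v] in
      exists t : nat -> nat,
        [/\ ra_eval f p (t 0%N),
            forall i, (i < thead v)%N ->
              ra_eval g [tuple of i :: t i :: p] (t i.+1)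
          & y = t (thead v)]
  | ra_min _ f => fun v y =>
      ra_eval f [tuple of y :: v] 0%N /\
      forall z, (z < y)%N -> exists u, ra_eval f [tuple of z :: v] u.+1
  end.

Lemma ra_eval_fun k (e : recalg k) v y z :
  ra_eval e v y -> ra_eval e v z -> y = z.
Proof.
elim: k / e v y z => /=.
- by move=> k v y z -> ->.
- by move=> v y z -> ->.
- by move=> k i v y z -> ->.
- move=> k l f IHf gs IHgs v y z [w [gw fy]] [w' [gw' fz]].
  have ww' : w = w' by apply: eq_from_tnth => i; exact: IHgs (gw i) (gw' i).
  by rewrite -ww' in fz; exact: IHf fy fz.
- move=> k f IHf g IHg v y z [t [t0 tS ->]] [t' [t0' tS' ->]].
  suff tt' i : (i <= thead v)%N -> t i = t' i by exact: tt'.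
  elim: i => [|i IHi] ltiv; first exact: IHf t0 t0'.
  have tii' := IHi (ltnW ltiv).
  have := tS' i ltiv; rewrite -tii'; exact: IHg (tS i ltiv).
- move=> k f IHf v y z [fy ly] [fz lz].
  case: (ltngtP y z) => // [/lz|/ly] [u fu].
  + by have := IHf _ _ _ fy fu.
  + by have := IHf _ _ _ fz fu.
Qed.

Definition computable k (f : k.-tuple nat -> nat) : Prop :=
  exists e : recalg k, forall v, ra_eval e v (f v).

Definition Pi02 k (S : set (k.-tuple nat)) : Prop :=
  exists P : k.+2.-tuple nat -> bool,
    computable (fun v => P v : nat) /\
    forall v, S v <-> forall x, exists y, P [tuple of x :: y :: v].

(** The triple [(a, b, c)] denotes the rational [(a - b) / (c + 1)]. *)
Definition rat_of_triple (v : 3.-tuple nat) : rat :=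
  ((tnth v (inord 0))%:R - (tnth v (inord 1))%:R) / (tnth v (inord 2)).+1%:R.

Definition Pi02_rat (S : set rat) : Prop := Pi02 (rat_of_triple @^-1` S).

Definition left_Pi02 (R : realType) (r : R) : Prop :=
  Pi02_rat [set q : rat | ratr q < r].

Definition n_ce (n : nat) (A : set nat) : Prop :=
  exists g : nat -> nat -> bool,
    computable (fun v : 2.-tuple nat =>
      g (tnth v (inord 0)) (tnth v (inord 1)) : nat) /\
    forall x : nat,
      [/\ g x 0%N = false,
          \forall s \near \oo, g x s = (x \in A)
        & [set s | g x s <> g x s.+1] #<= `I_n].

Definition partial_density (R : realType) (A : set nat) (m : nat) : R :=
  #|[pred j : 'I_m | (j : nat) \in A]|%:R / m%:R.

Definition has_density (R : realType) (A : set nat) : Prop :=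
  cvgn (partial_density R A).

Definition density (R : realType) (A : set nat) : R :=
  limn (partial_density R A).

(* Main.v *)
(** Writing [g x] for the approximation of [A x], the number [u x] of its rises
    and the number [d x] of its falls are at most [n] and [A x = u x - d x], so
    [rho_m(A)] is the mean of [u] minus the mean of [d] over [j < m].  As this
    difference converges, its limit is the difference of the two limits superior
    of means.  Since [u] and [d] are approximable from below, these limits
    superior are left-Pi02. *)
Require Import Defs.
From HB Require Import structures.
From mathcomp Require Import all_boot all_order all_algebra.
From mathcomp Require Import all_classical all_reals all_analysis.
From mathcomp Require Import finmap zify lra.
Import Order.TTheory GRing.Theory Num.Theory numFieldNormedType.Exports.

Set Implicit Arguments.
Unset Strict Implicit.
Unset Printing Implicit Defensive.

Local Open Scope classical_set_scope.
Local Open Scope card_scope.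
Local Open Scope ring_scope.

(** * Closure properties of computable functions *)

Lemma computable_const k c : computable (fun _ : k.-tuple nat => c).
Proof.
elim: c => [|c [e ev]]; first by exists (ra_zero k).
exists (ra_comp ra_succ (fun=> e)) => v /=.
by exists [tuple c]; split=> // i; rewrite (ord1 i) tnth0.
Qed.

Lemma computable_tnth k (i : 'I_k) : computable (fun v : k.-tuple nat => tnth v i).
Proof. by exists (ra_proj i). Qed.

(** Asking for one code per coordinate matches the family [gs] of [ra_comp]. *)
Definition computable_map k l (h : k.-tuple nat -> l.-tuple nat) :=
  forall i, computable (fun v => tnth (h v) i).

Lemma computable_comp k l (f : l.-tuple nat -> nat) (h : k.-tuple nat -> l.-tuple nat) :
  computable f -> computable_map h -> computable (f \o h).
Proof.
move=> [e ef] /choice[d dh].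
by exists (ra_comp e d) => v /=; exists (h v); split=> // i; exact: dh.
Qed.

Lemma computable_map_id k : computable_map (fun v : k.-tuple nat => v).
Proof. by move=> i; exact: computable_tnth. Qed.

Lemma computable_map_cons k l (a : k.-tuple nat -> nat) (h : k.-tuple nat -> l.-tuple nat) :
  computable a -> computable_map h -> computable_map (fun v => [tuple of a v :: h v]).
Proof.
move=> ca ch i; case: (unliftP ord0 i) => [j|] ->.
  by under eq_fun do rewrite tnthS; exact: ch.
by under eq_fun do rewrite tnth0.
Qed.

Definition tbehead T k (w : k.+1.-tuple T) : k.-tuple T := [tuple of behead w].

Lemma tbehead_cons T k (x : T) (v : k.-tuple T) : tbehead [tuple of x :: v] = v.
Proof. exact: val_inj. Qed.

Lemma computable_map_tbehead k l (h : k.-tuple nat -> l.+1.-tuple nat) :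
  computable_map h -> computable_map (fun v => tbehead (h v)).
Proof. by move=> ch i; under eq_fun do rewrite tnth_behead; exact: ch. Qed.

Lemma computable_thead k l (h : k.-tuple nat -> l.+1.-tuple nat) :
  computable_map h -> computable (fun v => thead (h v)).
Proof. by move=> ch; exact: ch. Qed.

(** [ra_rec] recurses on the head of its input with the tail as parameters. Prepending [b v] to [v]
    allows any computable bound while all of [v] stays available. *)
Lemma computable_natrec k (f b : k.-tuple nat -> nat)
    (g : nat -> nat -> k.-tuple nat -> nat) :
  computable f -> computable b ->
  computable (fun w : k.+2.-tuple nat =>
    g (thead w) (thead (tbehead w)) (tbehead (tbehead w))) ->
  computable (fun v => nat_rect _ (f v) (fun i t => g i t v) (b v)).
Proof.
move=> [ef cf] cb [eg cg].
pose r (w : k.+1.-tuple nat) : nat :=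
  nat_rect _ (f (tbehead w)) (fun i t => g i t (tbehead w)) (thead w).
have cr : computable r.
  exists (ra_rec ef eg) => w /=.
  exists (nat_rect _ (f (tbehead w)) (fun i t => g i t (tbehead w))).
  split=> // i _ /=; set t := nat_rect _ _ _ i.
  have := cg [tuple of i :: [tuple of t :: tbehead w]].
  by rewrite theadE !tbehead_cons theadE.
have -> : (fun v => nat_rect _ (f v) (fun i t => g i t v) (b v)) =
    r \o (fun v => [tuple of b v :: v]).
  by apply: funext => v; rewrite /r /= theadE tbehead_cons.
apply: computable_comp => //; apply: computable_map_cons => //.
exact: computable_map_id.
Qed.

Lemma computable_comp_tbehead2 k (f : k.-tuple nat -> nat) : computable f ->
  computable (fun w : k.+2.-tuple nat => f (tbehead (tbehead w))).
Proof.
move=> cf; apply: (computable_comp cf).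
exact/computable_map_tbehead/computable_map_tbehead/computable_map_id.
Qed.

Lemma computable_thead_tbehead k :
  computable (fun w : k.+2.-tuple nat => thead (tbehead w)).
Proof. exact/computable_thead/computable_map_tbehead/computable_map_id. Qed.

Lemma computable_succ k (f : k.-tuple nat -> nat) :
  computable f -> computable (fun v => (f v).+1).
Proof.
move=> [e ef]; exists (ra_comp ra_succ (fun=> e)) => v /=.
by exists [tuple f v]; split=> // i; rewrite (ord1 i) tnth0.
Qed.

Lemma computable_add k (f g : k.-tuple nat -> nat) :
  computable f -> computable g -> computable (fun v => f v + g v)%N.
Proof.
move=> cf cg; have := @computable_natrec _ f g (fun _ t _ => t.+1) cf cg
  (computable_succ (@computable_thead_tbehead k)).
congr computable; apply: funext => v.
by elim: (g v) => [|m /= ->]; rewrite (addn0, addnS).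
Qed.

(** The recursion returns the index of its last step, and its initial value 0 when there is no
    step. *)
Lemma computable_pred k (f : k.-tuple nat -> nat) :
  computable f -> computable (fun v => (f v).-1).
Proof.
move=> cf; have := @computable_natrec _ _ f (fun i _ _ => i) (computable_const k 0) cf
  (computable_thead (@computable_map_id _)).
by congr computable; apply: funext => v; case: (f v).
Qed.

Lemma computable_mul k (f g : k.-tuple nat -> nat) :
  computable f -> computable g -> computable (fun v => f v * g v)%N.
Proof.
move=> cf cg; have := @computable_natrec _ _ g (fun _ t v => t + f v)%N (computable_const k 0) cg
  (computable_add (@computable_thead_tbehead k) (computable_comp_tbehead2 cf)).
congr computable; apply: funext => v.
by elim: (g v) => [|m /= ->]; rewrite ?muln0 // mulnS addnC.
Qed.

Lemma computable_sub k (f g : k.-tuple nat -> nat) :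
  computable f -> computable g -> computable (fun v => f v - g v)%N.
Proof.
move=> cf cg; have := @computable_natrec _ f g (fun _ t _ => t.-1) cf cg
  (computable_pred (@computable_thead_tbehead k)).
congr computable; apply: funext => v.
by elim: (g v) => [|m /= ->]; rewrite ?subn0 // subnS.
Qed.

(** The truth value is [1 - (f v - g v)] with truncated subtractions. *)
Lemma computable_leq k (f g : k.-tuple nat -> nat) :
  computable f -> computable g -> computable (fun v => (f v <= g v)%N : nat).
Proof.
move=> cf cg.
have := computable_sub (computable_const k 1) (computable_sub cf cg).
by congr computable; apply: funext => v; rewrite -subn_eq0; case: (f v - g v)%N.
Qed.

Lemma computable_sum k (b : k.-tuple nat -> nat) (f : nat -> k.-tuple nat -> nat) :
  computable b ->
  computable (fun w : k.+1.-tuple nat => f (thead w) (tbehead w)) ->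
  computable (fun v => \sum_(i < b v) f i v)%N.
Proof.
move=> cb cf.
have cg : computable (fun w : k.+2.-tuple nat =>
    thead (tbehead w) + f (thead w) (tbehead (tbehead w)))%N.
  apply: computable_add; first exact: computable_thead_tbehead.
  pose h (w : k.+2.-tuple nat) : k.+1.-tuple nat :=
    [tuple of thead w :: tbehead (tbehead w)].
  have ch : computable_map h.
    apply: computable_map_cons; first exact/computable_thead/computable_map_id.
    exact/computable_map_tbehead/computable_map_tbehead/computable_map_id.
  have := computable_comp cf ch.
  by congr computable; apply: funext => w /=; rewrite theadE tbehead_cons.
have := @computable_natrec _ _ b (fun i t v => t + f i v)%N (computable_const k 0) cb cg.
congr computable; apply: funext => v.
by elim: (b v) => [|m /= ->]; rewrite ?big_ord0 // big_ord_recr.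
Qed.

(** This lets a binary function given as in [n_ce] be applied inside larger terms. *)
Lemma computable_app2 k (G : nat -> nat -> nat) (a b : k.-tuple nat -> nat) :
  computable (fun v : 2.-tuple nat => G (tnth v (inord 0)) (tnth v (inord 1))) ->
  computable a -> computable b -> computable (fun v => G (a v) (b v)).
Proof.
move=> cG ca cb.
have ch : computable_map (fun v => [tuple a v; b v]).
  apply: (@computable_map_cons k 1 a (fun v => [tuple b v])) => //.
  by apply: (@computable_map_cons k 0 b (fun v => [tuple])) => // -[].
have := computable_comp cG ch.
by congr computable; apply: funext => v /=; rewrite !(tnth_nth 0) !inordK.
Qed.

(** * Left cuts of rational numbers *)

(** Cross-multiplying and moving the negative terms across leaves a comparison of natural numbers,
    hence a computable one. *)
Lemma ltr_nat_frac (F : realFieldType) (a b c p p' m : nat) : (0 < m)%N ->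
  ((a%:R - b%:R) / c.+1%:R < (p%:R - p'%:R) / m%:R :> F) =
  (a * m + p' * c.+1 < p * c.+1 + b * m)%N.
Proof.
move=> m0; rewrite ltr_pdivrMr ?ltr0n // mulrAC ltr_pdivlMr ?ltr0n //.
rewrite -(ltr_nat F) !natrD !natrM !mulrBl.
by rewrite ltrBlDr addrAC ltrBrDr.
Qed.

(** Both quantifiers are dummies: the matrix drops the first two entries. *)
Lemma Pi02_decidable k (P : k.-tuple nat -> bool) :
  computable (fun v => P v : nat) -> Pi02 [set v | P v].
Proof.
move=> cP; exists (fun w => P (tbehead (tbehead w))); split.
  exact: (computable_comp_tbehead2 cP).
have e x y (v : k.-tuple nat) : tbehead (tbehead [tuple of x :: y :: v]) = v by exact: val_inj.
by move=> v; split=> [Pv x|/(_ 0)[y]]; [exists 0; rewrite e | rewrite e].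
Qed.

Lemma rat_of_tripleP (q : rat) : exists v : 3.-tuple nat, q = rat_of_triple v.
Proof.
have [d dq] : exists d, denq q = d.+1%:Z.
  by case: (denq q) (denq_gt0 q) => [[|d]|] // _; exists d.
have [[a b] nq] : exists ab : nat * nat, numq q = ab.1%:Z - ab.2%:Z.
  case: (numq q) => [a|b]; first by exists (a, 0) => /=; rewrite subr0.
  by exists (0, b.+1) => /=; rewrite sub0r NegzE.
exists [tuple a; b; d].
rewrite /rat_of_triple !(tnth_nth 0) !inordK //= -[LHS]divq_num_den dq nq /=.
by rewrite rmorphB.
Qed.

Lemma left_Pi02_rat (R : realType) (q : rat) : left_Pi02 (ratr q : R).
Proof.
have [w ->] := rat_of_tripleP q.
set p := tnth w (inord 0); set p' := tnth w (inord 1); set d := tnth w (inord 2).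
pose P (v : 3.-tuple nat) := (tnth v (inord 0) * d.+1 + p' * (tnth v (inord 2)).+1 <
    p * (tnth v (inord 2)).+1 + tnth v (inord 1) * d.+1)%N.
have -> : left_Pi02 (ratr (rat_of_triple w) : R) = Pi02 [set v | P v].
  congr Pi02; apply/seteqP; split=> v /=;
    by rewrite /P ltr_rat /rat_of_triple ltr_nat_frac.
apply: Pi02_decidable.
have ct i := @computable_tnth 3 (inord i); have cc := @computable_const 3.
apply: computable_leq; first apply: computable_succ.
  by apply: computable_add; apply: computable_mul => //; exact: computable_succ.
by apply: computable_add; apply: computable_mul => //; exact: computable_succ.
Qed.

(** * Limits superior of bounded sequences *)

Section limn_sup.
Variable R : realType.
Implicit Types u v : R^nat.

Lemma bounded_fun_has_sup_sdrop u N : bounded_fun u -> has_sup (sdrop u N).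
Proof.
move=> bu; split; first by exists (u N); exists N => /=.
exact/has_ubound_sdrop/bounded_fun_has_ubound.
Qed.

(** The limit superior is the infimum of the suprema of tails, so [x] lies below each of these and
    some term of each tail exceeds it. *)
Lemma lt_limn_sup u x : bounded_fun u -> x < limn_sup u ->
  forall N, exists2 m, (N <= m)%N & x < u m.
Proof.
move=> bu; rewrite limn_supE // => xu N.
have : x < sups u N.
  apply: lt_le_trans xu _; apply: ge_inf; last by exists N.
  exact: bounded_fun_has_lbound_sups.
by move=> /(sup_gt (bounded_fun_has_sup_sdrop N bu).1)[_ [m /= Nm <-] xm]; exists m.
Qed.

(** Only [<=] can be concluded: terms above [x] may tend to [x]. *)
Lemma limn_sup_ge u x : bounded_fun u ->
  (forall N, exists2 m, (N <= m)%N & x < u m) -> x <= limn_sup u.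
Proof.
move=> bu xu; rewrite limn_supE //; apply: lb_le_inf; first by exists (sups u 0), 0.
move=> _ [N _ <-]; have [m Nm /ltW xm] := xu N.
apply: le_trans xm _; apply: ub_le_sup; last by exists m.
exact: (bounded_fun_has_sup_sdrop N bu).2.
Qed.

(** Subadditivity of the limit superior is used twice, for [u = v + (u - v)] and for
    [v = u - (u - v)]; on the convergent summand it is the limit. *)
Lemma limn_sup_subE u v : bounded_fun u -> bounded_fun v -> cvgn (u \- v) ->
  limn (u \- v) = limn_sup u - limn_sup v.
Proof.
move=> bu bv cuv.
have bw : bounded_fun (u \- v) by exact: cvg_seq_bounded.
have le1 : limn_sup u <= limn_sup v + limn (u \- v).
  rewrite -(cvg_limn_supE cuv); apply: le_trans (le_limn_supD bv bw).
  by rewrite (_ : v \+ (u \- v) = u) //; apply: funext => m /=; rewrite addrC subrK.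
have le2 : limn_sup v <= limn_sup u - limn (u \- v).
  rewrite -limN // -(@cvg_limn_supE _ (- (u \- v))); last exact: is_cvgN.
  apply: le_trans (le_limn_supD bu (bounded_funN bw)).
  rewrite (_ : u \+ - (u \- v) = v) //; apply: funext => m /=.
  by rewrite !fctE opprB addrC subrK.
lra.
Qed.

End limn_sup.

(** * Limits superior of means of functions approximable from below *)

Definition partial_mean (R : realType) (l : nat -> nat) (m : nat) : R :=
  (\sum_(j < m) l j)%N%:R / m%:R.

Lemma partial_mean_bounded (R : realType) (l : nat -> nat) n :
  (forall j, l j <= n)%N -> bounded_fun (partial_mean R l).
Proof.
move=> ln; exists n%:R; split; first exact: num_real.
move=> x nx m _ /=; apply: le_trans (ltW nx).
rewrite ger0_norm /partial_mean; last by rewrite divr_ge0.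
(* The mean at index 0 is 0, since the inverse of 0 is 0. *)
case: m => [|m]; first by rewrite invr0 mulr0.
rewrite ler_pdivrMr ?ltr0n // -natrM ler_nat.
rewrite mulnC -[X in (X * _)%N]card_ord -sum_nat_const; exact: leq_sum.
Qed.

(* At an irrational limit superior the strict cut is [q < u m] for infinitely
   many [m]; at a rational one it is decidable. *)
Lemma left_Pi02_limn_sup_mean (R : realType) (h : nat -> nat -> nat)
    (l : nat -> nat) n :
  computable (fun v : 2.-tuple nat => h (tnth v (inord 0)) (tnth v (inord 1))) ->
  (forall j, {homo h j : s t / (s <= t)%N}) ->
  (forall j, \forall s \near \oo, h j s = l j) ->
  (forall j, l j <= n)%N ->
  left_Pi02 (limn_sup (partial_mean R l)).
Proof.
move=> ch hh hl ln; set L := limn_sup _.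
have bu := partial_mean_bounded R ln.
have [[q <-]|irr] := pselect (exists q, ratr q = L); first exact: left_Pi02_rat.
have hle j s : (h j s <= l j)%N.
  have [N _ hN] := hl j; rewrite -(hN (maxn N s)) ?hh ?leq_maxr //=.
  exact: leq_maxl.
(* Finitely many approximations share a stage from which all are final. *)
have hm m : exists T, forall s, (T <= s)%N ->
    (\sum_(j < m) h j s = \sum_(j < m) l j)%N.
  elim: m => [|m [T IH]]; first by exists 0 => s _; rewrite !big_ord0.
  have [N _ hN] := hl m; exists (maxn T N) => s; rewrite geq_max => /andP[Ts Ns].
  by rewrite !big_ord_recr /= IH // hN.
pose K m s := (\sum_(j < m) h j s)%N.
(* For [w = (x, y, a, b, c)] and [m > 0] this is [(a - b) / (c + 1) < K m y / m] multiplied out,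
   with [y] as the stage. *)
pose Q m (w : 5.-tuple nat) :=
  (tnth w (inord 2) * m <
   K m (tnth w (inord 1)) * (tnth w (inord 4)).+1 + tnth w (inord 3) * m)%N.
(* A single [y] bounds both the index [m] and the stage, [h] being monotone. *)
pose P (w : 5.-tuple nat) :=
  (0 < \sum_(m < tnth w (inord 1)) (tnth w (inord 0) <= m) * Q m w)%N.
have cP : computable (fun w => P w : nat).
  have ct i := @computable_tnth 5 (inord i).
  have ct' i : computable (fun w : 6.-tuple nat => tnth (tbehead w) (inord i : 'I_5)).
    exact: (computable_map_tbehead (@computable_map_id 6) (inord i)).
  have cm : computable (fun w : 6.-tuple nat => thead w).
    exact/computable_thead/computable_map_id.
  apply: computable_leq; first exact: computable_const.
  apply: (computable_sum (f := fun m w => (tnth w (inord 0) <= m) * Q m w)%N) => //.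
  apply: computable_mul; first exact: computable_leq.
  apply: computable_leq; first by apply/computable_succ/computable_mul.
  apply: computable_add; last exact: computable_mul.
  apply: computable_mul; last exact: computable_succ.
  apply: (computable_sum (f := fun j w => h j (tnth (tbehead w) (inord 1)))) => //.
  apply: computable_app2 => //; first exact/computable_thead/computable_map_id.
  exact: (computable_map_tbehead (computable_map_tbehead (@computable_map_id 7)) (inord 1)).
exists P; split=> // v.
have QE m x y : (0 < m)%N -> Q m [tuple of x :: y :: v] =
    (ratr (rat_of_triple v) < (K m y)%:R / m%:R :> R).
  move=> m0; rewrite /Q /rat_of_triple !(tnth_nth 0) !inordK //=.
  rewrite fmorph_div rmorphB !rmorph_nat.
  have -> : (K m y)%:R = (K m y)%:R - 0%:R :> R by rewrite subr0.
  by rewrite ltr_nat_frac // mul0n addn0.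
have PE x y : P [tuple of x :: y :: v] <->
    exists m, [/\ (m < y)%N, (x <= m)%N & Q m [tuple of x :: y :: v]].
  rewrite /P !(tnth_nth 0) !inordK //= lt0n sum_nat_eq0 negb_forall; split.
    move=> /existsP[m]; rewrite /= muln_eq0 negb_or !eqb0 !negbK => /andP[xm Qm].
    by exists m.
  move=> [m [my xm Qm]]; apply/existsP; exists (Ordinal my).
  by rewrite /= xm Qm.
split=> [/= qL x|qu].
  (* Asking for an index of at least [x.+1] excludes 0. *)
  have [[//|m] xm qm] := lt_limn_sup bu qL x.+1; have [T hT] := hm m.+1.
  (* The bound [m.+2] puts the index [m.+1] strictly below [y]; the bound [T] makes [K] final. *)
  exists (maxn m.+2 T); apply/PE; exists m.+1; split; first exact: leq_maxl.
    exact: ltnW.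
  by rewrite QE // /K hT // leq_maxr.
rewrite /= lt_neqAle; apply/andP; split.
  by apply/eqP => qL; apply: irr; exists (rat_of_triple v).
apply: limn_sup_ge => // x; have [y /PE[[|m] [my xm]]] := qu x.
  (* Index 0 is no witness: [Q 0] reads [0 < 0]. *)
  by rewrite /Q /K big_ord0 !muln0 mul0n.
(* The mean at stage [y] is at most the true one, as [h] stays below [l]. *)
rewrite QE // => qm; exists m.+1 => //; apply: lt_le_trans qm _.
rewrite /partial_mean ler_pdivrMr ?ltr0n // divfK // ler_nat.
by apply: leq_sum => j _; exact: hle.
Qed.

(** * Counting the rises of a binary sequence *)

(* The truncated difference is [1] exactly when [s] goes from [false] to [true]. *)
Definition rises (s : nat -> bool) (t : nat) : nat := \sum_(r < t) (s r.+1 - s r)%N.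

Lemma rises_homo (s : nat -> bool) : {homo rises s : t t' / (t <= t')%N}.
Proof.
apply: homo_leq => [t //|t u w|t]; first exact: leq_trans.
by rewrite /rises big_ord_recr leq_addr.
Qed.

(** Falls of [s] are rises of its negation, and rises minus falls telescope to [s t - s 0]. *)
Lemma rises_neg (s : nat -> bool) t :
  (rises s t + s 0 = rises (fun r => ~~ s r) t + s t)%N.
Proof.
elim: t => [|t]; first by rewrite /rises !big_ord0.
rewrite /rises !big_ord_recr /=.
by case: (s t); case: (s t.+1); rewrite /= ?subnn; lia.
Qed.

Lemma rises_le_card_changes (s : nat -> bool) n t :
  [set r | s r <> s r.+1] #<= `I_n -> (rises s t <= n)%N.
Proof.
set C := [set r | _] => Cn.
have finC : finite_set C by exact: card_le_finite Cn (finite_II n).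
apply: leq_trans (geq_card_fset_set Cn).
rewrite /rises -(big_mkord xpredT (fun r => (s r.+1 - s r)%N)).
apply: (@leq_trans (\sum_(0 <= r < t) (s r != s r.+1))%N).
  by apply: leq_sum => r _; case: (s r); case: (s r.+1).
(* The stages of change below [t] form a duplicate-free list inside [C]. *)
rewrite -big_mkcond sum1_count -size_filter; apply: uniq_leq_size.
  exact/filter_uniq/iota_uniq.
move=> r; rewrite mem_filter => /andP[/eqP sr _].
by rewrite in_fset_set //; apply: mem_set.
Qed.

(** No rise occurs once [s] is constant, so the count at such a stage [N] is final. *)
Lemma rises_lim (s : nat -> bool) b n :
  (\forall r \near \oo, s r = b) -> [set r | s r <> s r.+1] #<= `I_n ->
  exists l, (\forall t \near \oo, rises s t = l) /\ (l <= n)%N.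
Proof.
move=> [N _ sN] sn; exists (rises s N); split; last exact: rises_le_card_changes.
exists N => // t /= Nt; rewrite -(subnKC Nt).
elim: (t - N)%N => [|d IH]; first by rewrite addn0.
rewrite addnS /rises big_ord_recr /= -/(rises s _) IH.
by rewrite !sN ?subnn ?addn0 //= ?leq_addr // -addnS leq_addr.
Qed.

Lemma computable_rises (g : nat -> nat -> bool) :
  computable (fun v : 2.-tuple nat => g (tnth v (inord 0)) (tnth v (inord 1)) : nat) ->
  computable (fun v : 2.-tuple nat => rises (g (tnth v (inord 0))) (tnth v (inord 1))).
Proof.
move=> cg; pose G x y : nat := g x y.
apply: (computable_sum
  (f := fun r v => (G (tnth v (inord 0)) r.+1 - G (tnth v (inord 0)) r)%N)).
  exact: computable_tnth.
have cr : computable (fun w : 3.-tuple nat => thead w).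
  exact/computable_thead/computable_map_id.
have cx := computable_map_tbehead (@computable_map_id 3) (inord 0).
apply: computable_sub; apply: (computable_app2 (G := G)) => //.
exact: computable_succ.
Qed.

(** * Densities of n-c.e. sets *)

Theorem theorem4p2 (R : realType) (n : nat) (A : set nat)
  (n_ge1 : (1 <= n)%N) (A_nce : n_ce n A) (A_dens : has_density R A) :
  exists a b : R, [/\ left_Pi02 a, left_Pi02 b & density R A = a - b].
Proof.
case: A_nce => g [cg gP].
(* The rises of [g'] are the falls of [g]. *)
pose g' x s := ~~ g x s.
have cg' : computable (fun v : 2.-tuple nat =>
    g' (tnth v (inord 0)) (tnth v (inord 1)) : nat).
  have := computable_sub (computable_const 2 1) cg.
  by congr computable; apply: funext => v; rewrite /g'; case: (g _ _).
have /choice[u uP] x : exists l, (\forall t \near \oo, rises (g x) t = l) /\ (l <= n)%N.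
  by have [_ gA gn] := gP x; exact: rises_lim gA gn.
have /choice[d dP] x : exists l, (\forall t \near \oo, rises (g' x) t = l) /\ (l <= n)%N.
  have [_ gA gn] := gP x; apply: (@rises_lim _ (x \notin A)).
    by apply: filterS gA => s; rewrite /g' => ->.
  (* Negation preserves the stages of change, so the same bound [n] applies. *)
  rewrite (_ : [set r | _] = [set s | g x s <> g x s.+1]) //.
  by apply/seteqP; split=> r /=; rewrite /g'; case: (g x r); case: (g x r.+1).
have un x : (u x <= n)%N by case: (uP x).
have dn x : (d x <= n)%N by case: (dP x).
have ud x : (u x = d x + (x \in A))%N.
  have [g0 gA _] := gP x; have [ux _] := uP x; have [dx _] := dP x.
  (* At some stage [t] both counts are final and [g x t] is correct; there the telescoped identity,
     with [g x 0 = false], gives the claim. *)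
  have /filter_ex[t [[<- <-] <-]] :
      \forall t \near \oo, (rises (g x) t = u x /\ rises (g' x) t = d x) /\ g x t = (x \in A).
    by apply: filterI => //; exact: filterI.
  by have := rises_neg (g x) t; rewrite g0 addn0.
have AE : partial_density R A = partial_mean R u \- partial_mean R d.
  apply: funext => m; rewrite /= /partial_density /partial_mean -mulrBl; congr (_ / _).
  (* Substituting [d + A] for [u] cancels the sum of [d] and leaves the number of elements of [A]
     below [m]. *)
  under [X in _ = X%:R - _]eq_bigr do rewrite ud.
  rewrite big_split natrD addrC addKr -sum1_card big_mkcond.
  by congr (_%:R); apply: eq_bigr => j _; rewrite unfold_in /=; case: (_ \in A).
exists (limn_sup (partial_mean R u)), (limn_sup (partial_mean R d)); split.
- exact: left_Pi02_limn_sup_mean (computable_rises cg) (fun x => @rises_homo (g x))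
    (fun x => (uP x).1) un.
- exact: left_Pi02_limn_sup_mean (computable_rises cg') (fun x => @rises_homo (g' x))
    (fun x => (dP x).1) dn.
rewrite /density AE limn_sup_subE //; first exact: partial_mean_bounded un.
  exact: partial_mean_bounded dn.
by rewrite -AE.
Qed.
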